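(* Let $D_0,\dots,D_K$ be a finite renormalized audit chain and let $w_k\ge0$ for $0\le k\le K$. Assume each scale carries a valid certificate $$M_k\ge c_k\delta_k-E_k,\qquad 0\le k\le K.$$ Set $c_K^{\min}:=\min_{0\le k\le K}c_k$ and $\mathcal E_K^{\mathrm{rec}}:=\sum_{k=0}^Kw_kE_k$. Then $$\sum_{k=0}^Kw_kM_k\ge c_K^{\min}\sum_{k=0}^Kw_k\delta_k-\mathcal E_K^{\mathrm{rec}}.$$ Moreover, if $E_{k+1}\le a_kE_k+b_k\Delta_k$ for $0\le k\le K-1$ with $a_k,b_k\ge0$, then on each prefix of the chain, i.e. for every $0\le k\le K$, $$E_k\le\Bigl(\prod_{i=0}^{k-1}a_i\Bigr)E_0+\sum_{j=0}^{k-1}b_j\Bigl(\prod_{i=j+1}^{k-1}a_i\Bigr)\Delta_j,$$ with empty products equal to $1$ and empty sums equal to $0$.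
   Context: A finite renormalized audit chain is a finite sequence of packages $D_0\to D_1\to\dots\to D_K$; package $D_k$ carries real numbers: the localized detector value $M_k$, the baseline quotient defect distance $\delta_k\ge0$, the total residual/error budget $E_k$, the finite-window audit coefficient $c_k\ge0$; and each step $k\to k+1$ carries a one-step increment $\Delta_k\ge0$. Only these numbers enter the statement. *)

(* Defs.v *)
From mathcomp Require Import all_boot all_order all_algebra.
From mathcomp Require Import reals.

Set Implicit Arguments.
Unset Strict Implicit.
Unset Printing Implicit Defensive.

Import Order.TTheory GRing.Theory Num.Theory.
Local Open Scope ring_scope.

(* A chain D_0 -> ... -> D_K is represented by the numbers it carries.  Sequences
   are indexed by nat, but only the values at packages k <= K and at steps
   k -> k.+1 with k < K are meaningful; the others are unconstrained. *)
Record audit_chain (R : realType) (K : nat) := AuditChain {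
  detector : nat -> R;   (* M_k *)
  defect : nat -> R;     (* delta_k *)
  budget : nat -> R;     (* E_k *)
  audit_coef : nat -> R; (* c_k *)
  increment : nat -> R;  (* Delta_k, for the step k -> k.+1 *)
  defect_ge0 : forall k, (k <= K)%N -> 0 <= defect k;
  audit_coef_ge0 : forall k, (k <= K)%N -> 0 <= audit_coef k;
  increment_ge0 : forall k, (k < K)%N -> 0 <= increment k
}.

Definition valid_certificate (R : realType) (K : nat) (D : audit_chain R K)
    (k : nat) : Prop :=
  audit_coef D k * defect D k - budget D k <= detector D k.

(* Seeding the iterated minimum with c_0, itself one of the terms, makes it the
   minimum of c_0, ..., c_K. *)
Definition min_audit_coef (R : realType) (K : nat) (D : audit_chain R K) : R :=
  \big[Num.min/audit_coef D 0%N]_(k < K.+1) audit_coef D k.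

Definition rec_error (R : realType) (K : nat) (D : audit_chain R K)
    (w : nat -> R) : R :=
  \sum_(0 <= k < K.+1) w k * budget D k.

(* Main.v *)
Require Import Defs.
From mathcomp Require Import all_boot all_order all_algebra.
From mathcomp Require Import reals.
Import Order.TTheory GRing.Theory Num.Theory.
Local Open Scope ring_scope.

(** The weighted inequality holds term by term: as [defect D k] is nonnegative, the certificate
    survives lowering its coefficient to the minimum ([min_audit_coef_le]); it is then scaled by
    [w k] and summed. The budget bound is a discrete Grönwall estimate ([discrete_gronwall]),
    obtained by unrolling the one-step recursion. *)

Lemma min_audit_coef_le (R : realType) (K : nat) (D : audit_chain R K) (k : nat) :
  (k <= K)%N -> min_audit_coef D <= audit_coef D k.
Proof.
move=> lekK; have ltk : (k < K.+1)%N by [].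
exact: (bigmin_le _ (Ordinal ltk) (fun i : 'I_K.+1 => audit_coef D i)).
Qed.

(** Induction on [k]: multiplying the bound at [k] by [a k], which is nonnegative, appends this
    factor to every product, while [b k * d k] enters as the new last summand. *)
Lemma discrete_gronwall (R : numDomainType) (K : nat) (x a b d : nat -> R) :
  (forall k : nat, (k < K)%N -> 0 <= a k) ->
  (forall k : nat, (k < K)%N -> x k.+1 <= a k * x k + b k * d k) ->
  forall k : nat, (k <= K)%N ->
    x k <= (\prod_(0 <= i < k) a i) * x 0%N
           + \sum_(0 <= j < k) b j * (\prod_(j.+1 <= i < k) a i) * d j.
Proof.
move=> a_ge0 step; elim=> [_|k IHk ltkK].
  by rewrite !big_geq // mul1r addr0.
apply: (le_trans (step k ltkK)).
rewrite big_nat_recr //= [\sum_(0 <= j < k.+1) _]big_nat_recr //=.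
(* The summand [j = k] carries an empty product, so it is exactly [b k * d k] and cancels against
   the recursion. *)
rewrite (big_geq (leqnn k.+1)) mulr1 addrA lerD2r.
apply: (le_trans (ler_wpM2l (a_ge0 k ltkK) (IHk (ltnW ltkK)))).
rewrite mulrDr mulrA (mulrC (a k)) lerD2l mulr_sumr.
apply: ler_sum_nat => j /andP[_ ltjk].
(* Since [j < k], the range from [j.+1] does contain [k], so the factor [a k] can be split off. *)
by rewrite (big_nat_recr k) //= mulrA (mulrC (a k)) mulrA.
Qed.

Theorem theorem10p3 (R : realType) (K : nat) (D : audit_chain R K)
    (w : nat -> R)
    (w_ge0 : forall k : nat, (k <= K)%N -> 0 <= w k)
    (cert : forall k : nat, (k <= K)%N -> valid_certificate D k) :
  (\sum_(0 <= k < K.+1) w k * detector D k >=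
     min_audit_coef D * (\sum_(0 <= k < K.+1) w k * defect D k)
     - rec_error D w)
  /\
  (forall a b : nat -> R,
     (forall k : nat, (k < K)%N -> 0 <= a k) ->
     (forall k : nat, (k < K)%N -> 0 <= b k) ->
     (forall k : nat, (k < K)%N ->
        budget D k.+1 <= a k * budget D k + b k * increment D k) ->
     forall k : nat, (k <= K)%N ->
       budget D k <=
         (\prod_(0 <= i < k) a i) * budget D 0%N
         + \sum_(0 <= j < k) b j * (\prod_(j.+1 <= i < k) a i) * increment D j).
Proof.
split; last by move=> a b a_ge0 _ step; exact: discrete_gronwall a_ge0 step.
rewrite /rec_error mulr_sumr -sumrB; apply: ler_sum_nat => k /andP[_ lekK].
(* Factoring out [w k] leaves the certificate at [k] with the minimal coefficient. *)
rewrite mulrCA -mulrBr ler_wpM2l ?w_ge0 //.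
apply: le_trans (cert k lekK); rewrite lerD2r.
by rewrite ler_wpM2r ?defect_ge0 ?min_audit_coef_le.
Qed.
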